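(* Let $E$ be a separable Baire locally convex space and let $Y=\prod_{\alpha\in A}E_\alpha$ be the product (with the product topology) of any family $\{E_\alpha:\alpha\in A\}$ of separable Fréchet spaces. Then the product $E\times Y$ is Weak Asplund.
   Context: All vector spaces are over $\mathbb{R}$ and all topological vector spaces are Hausdorff. A Fréchet space is a completely metrizable locally convex space. A topological space is Baire if the intersection of every countable sequence of its dense open subsets is dense; a locally convex space is Baire if its underlying topological space is. Let $X$ be a locally convex space with continuous dual $X'$ and let $D\subset X$ be a nonempty open convex set. A convex function $f:D\to\mathbb{R}$ is Gâteaux differentiable at $x_0\in D$ if there is a continuous linear functional $f'(x_0)\in X'$ such that for every $x\in X$ and $\epsilon>0$ there is $\delta>0$ such that $\left|\frac{f(x_0+tx)-f(x_0)}{t}-\langle f'(x_0),x\rangle\right|<\epsilon$ whenever $0<|t|<\delta$ (with $\delta$ small enough that $x_0+tx\in D$). A locally convex space $X$ is Weak Asplund (WASP) if for every nonempty open convex $D\subset X$, every continuous convex function $f:D\to\mathbb{R}$ is Gâteaux differentiable at every point of some dense $G_\delta$ subset of $D$. *)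

(* Defs.v *)
From HB Require Import structures.
From mathcomp Require Import all_boot all_order all_algebra.
From mathcomp Require Import all_classical all_reals all_analysis.
From mathcomp Require Import borel_hierarchy.

Set Implicit Arguments.
Unset Strict Implicit.
Unset Printing Implicit Defensive.

Import Order.TTheory GRing.Theory Num.Theory.
Import numFieldNormedType.Exports.

Local Open Scope classical_set_scope.
Local Open Scope ring_scope.

Section product_topology_facts.
Context {I : Type} {T : I -> topologicalType}.

Lemma prod_topology_proj_continuous (i : I) :
  continuous ((fun f => f i) : prod_topology T -> T i).
Proof.
move=> f A /= fA.
have /cvg_sup/(_ i) : f --> (f : prod_topology T) by exact: cvg_id.
by apply; exact: (@initial_continuous _ _ (fun g : forall i, T i => g i) f A fA).
Qed.

Lemma continuous_prod_topology {S : topologicalType} (g : S -> prod_topology T) :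
  (forall i, continuous (fun s => g s i)) -> continuous g.
Proof.
move=> gc s; apply/cvg_sup => i A /= [B [[C oC <-] /= Csi] CA].
apply: filterS CA _; exact: (gc i s _ (open_nbhs_nbhs (conj oC Csi))).
Qed.

End product_topology_facts.

(* The library topologizes [prod_topology E] but gives it no vector space
   structure, since its lmodType of functions is not dependent. *)
Section product_tvs.
Context {R : numFieldType} {I : Type} (E : I -> tvsType R).
Local Notation P := (prod_topology E).

Let add (f g : P) : P := fun i => f i + g i.
Let zero : P := fun=> 0.
Let opp (f : P) : P := fun i => - f i.
Let scale (k : R) (f : P) : P := fun i => k *: f i.

Let addA : associative add.
Proof. by move=> f g h; apply: functional_extensionality_dep => i; exact: addrA. Qed.

Let addC : commutative add.
Proof. by move=> f g; apply: functional_extensionality_dep => i; exact: addrC. Qed.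

Let add0 : left_id zero add.
Proof. by move=> f; apply: functional_extensionality_dep => i; exact: add0r. Qed.

Let addN : left_inverse zero opp add.
Proof. by move=> f; apply: functional_extensionality_dep => i; exact: addNr. Qed.

HB.instance Definition _ := GRing.isZmodule.Build P addA addC add0 addN.

Let scaleA k l (f : P) : scale k (scale l f) = scale (k * l) f.
Proof. by apply: functional_extensionality_dep => i; exact: scalerA. Qed.

Let scale1 : left_id 1 scale.
Proof. by move=> f; apply: functional_extensionality_dep => i; exact: scale1r. Qed.

Let scaleDr : right_distributive scale +%R.
Proof. by move=> k f g; apply: functional_extensionality_dep => i; exact: scalerDr. Qed.

Let scaleDl (f : P) : {morph scale^~ f : k l / k + l}.
Proof. by move=> k l; apply: functional_extensionality_dep => i; exact: scalerDl. Qed.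

HB.instance Definition _ :=
  GRing.Zmodule_isLmodule.Build R P scaleA scale1 scaleDr scaleDl.

Let add_continuous : continuous (fun x : P * P => x.1 + x.2).
Proof.
apply: continuous_prod_topology => i x.
apply: (@continuous2_cvg _ _ _ _ _ _ (fun x : P * P => x.1 i) (fun x => x.2 i)
  (fun a b : E i => a + b)).
- exact: (@add_continuous (E i) (x.1 i, x.2 i)).
- by apply: (cvg_comp fst (fun f : P => f i) cvg_fst);
    exact: prod_topology_proj_continuous.
- by apply: (cvg_comp snd (fun f : P => f i) cvg_snd);
    exact: prod_topology_proj_continuous.
Qed.

Let scale_continuous : continuous (fun z : R^o * P => z.1 *: z.2).
Proof.
apply: continuous_prod_topology => i x.
apply: (@continuous2_cvg _ _ _ _ _ _ (fun x : R^o * P => x.1) (fun x => x.2 i)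
  (fun (a : R^o) (b : E i) => a *: b)).
- exact: (@scale_continuous R (E i) (x.1, x.2 i)).
- exact: cvg_fst.
- by apply: (cvg_comp snd (fun f : P => f i) cvg_snd);
    exact: prod_topology_proj_continuous.
Qed.

Let locally_convex :
  exists2 B : set_system P, (forall b, b \in B -> convex_set b) & basis B.
Proof.
exists [set U | open U /\ convex_set U]; first by move=> b /set_mem[].
split=> [U []//|x].
have FF : Filter (filter_from [set U : set P | (open U /\ convex_set U) /\ U x] id).
  apply: filter_from_filter.
    exists setT; split=> //; split; first exact: openT.
    by move=> ? ? ? _ _; rewrite inE.
  move=> U V [[oU cU] Ux] [[oV cV] Vx]; exists (U `&` V) => //; split=> //.
  split; first exact: openI.
  move=> y z l /set_mem[Uy Vy] /set_mem[Uz Vz]; apply/mem_set; split.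
    by apply/set_mem/cU; exact/mem_set.
  by apply/set_mem/cV; exact/mem_set.
apply/cvg_sup => i A [_ [[C oC <-] /= Cxi] CA].
have [B Bc [Bo Bb]] := @locally_convex R (E i).
have [U [BU Uxi] UC] := Bb (x i) C (open_nbhs_nbhs (conj oC Cxi)).
exists [set f : P | U (f i)]; last by move=> f /= /UC; exact: CA.
split=> //; split.
  by apply: open_comp (Bo _ BU) => f _; exact: prod_topology_proj_continuous.
move=> f g l /set_mem Uf /set_mem Ug; apply/mem_set => /=.
have /(_ (f i) (g i) l) := Bc _ (mem_set BU).
by move=> /(_ (mem_set Uf) (mem_set Ug)) /set_mem.
Qed.

HB.instance Definition _ :=
  PreTopologicalNmodule_isTopologicalNmodule.Build P add_continuous.
HB.instance Definition _ :=
  TopologicalNmodule_isTopologicalLmodule.Build R P scale_continuous.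
HB.instance Definition _ := Uniform_isTvs.Build R P locally_convex.

End product_tvs.

Lemma prod_tvs_addE {R : numFieldType} {I : Type} (E : I -> tvsType R)
  (f g : prod_topology E) i : (f + g) i = f i + g i.
Proof. by []. Qed.

Lemma prod_tvs_zeroE {R : numFieldType} {I : Type} (E : I -> tvsType R) i :
  (0 : prod_topology E) i = 0.
Proof. by []. Qed.

Lemma prod_tvs_oppE {R : numFieldType} {I : Type} (E : I -> tvsType R)
  (f : prod_topology E) i : (- f) i = - f i.
Proof. by []. Qed.

Lemma prod_tvs_scaleE {R : numFieldType} {I : Type} (E : I -> tvsType R)
  (k : R) (f : prod_topology E) i : (k *: f) i = k *: f i.
Proof. by []. Qed.

Definition separable_space (T : topologicalType) :=
  exists2 S : set T, countable S & dense S.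

Definition baire_space (T : topologicalType) :=
  forall F : (set T)^nat,
    (forall i, open (F i) /\ dense (F i)) -> dense (\bigcap_i F i).

Definition is_metric (R : realType) (T : Type) (d : T -> T -> R) :=
  [/\ forall x y, 0 <= d x y,
      forall x y, d x y = 0 <-> x = y,
      forall x y, d x y = d y x &
      forall x y z, d x z <= d x y + d y z].

Definition completely_metrizable (R : realType) (T : topologicalType) :=
  exists d : T -> T -> R,
    [/\ is_metric d,
        forall (x : T) (U : set T),
          nbhs x U <-> exists2 e, 0 < e & [set y | d x y < e] `<=` U &
        forall u : T^nat,
          (forall e, 0 < e -> exists N : nat, forall m n : nat,
              (N <= m)%N -> (N <= n)%N -> d (u m) (u n) < e) ->
          exists l : T, u @ \oo --> l].

(* Local convexity is part of tvsType and the Hausdorff property follows from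
   metrizability. The metric is not required to be translation invariant, and
   completeness refers to the metric, not to the uniform structure carried by
   X, which tvsType ties to the vector space only through its topology. *)
Definition frechet_space (R : realType) (X : tvsType R) :=
  completely_metrizable R X.

(* f stands for its restriction to D: only its values on D are used. *)
Definition gateaux_differentiable (R : realType) (X : tvsType R)
    (D : set X) (f : X -> R) (x0 : X) :=
  exists2 f' : {linear X -> R^o}, continuous f' &
    forall (x : X) (e : R), 0 < e ->
      exists2 delta : R, 0 < delta &
        forall t : R, 0 < `|t| -> `|t| < delta ->
          D (x0 + t *: x) /\ `|(f (x0 + t *: x) - f x0) / t - f' x| < e.

(* As D is open, the G-delta subsets of the subspace D are the G-delta subsets
   of X contained in D. *)
Definition weak_asplund (R : realType) (X : tvsType R) :=
  forall D : set X, D !=set0 -> open D -> convex_set D ->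
  forall f : X -> R, {within D, continuous f} -> convex_function D f ->
  exists G : set X,
    [/\ Gdelta G, G `<=` D, D `<=` closure G &
        forall x, G x -> gateaux_differentiable D f x].

(* Main.v *)
(** Since [f] is bounded above near a point [x0] of [D], it is bounded above on
    [x0 + L], where [L] is the subspace of the vectors whose [E]-coordinate and
    coordinates in some finite [s] vanish; by convexity [D] and [f] are then
    invariant under all translations by [L], so only [E] and finitely many
    factors matter.  For a direction [v] and [e > 0], the points [x] where
    [f (x + t v) + f (x - t v) - 2 f x < e t] for some [t > 0] form an open
    dense subset of [D].  Letting [v] range over a countable set that spans a
    dense subspace modulo [L], and [e] over [1 / n], these sets are
    [L]-invariant, and their intersection is dense because [E] times finitely
    many separable Frechet spaces is Baire.  At a point of the intersection, the
    directions along which [f] has a two-sided derivative form a closed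
    subspace, which is therefore everything. *)
Require Import Defs.
From HB Require Import structures.
From mathcomp Require Import all_boot all_order all_algebra.
From mathcomp Require Import all_classical all_reals all_analysis.
From mathcomp Require Import borel_hierarchy ring lra.
Set Implicit Arguments.
Unset Strict Implicit.
Unset Printing Implicit Defensive.
Import Order.TTheory GRing.Theory Num.Theory.
Import numFieldNormedType.Exports.
Local Open Scope classical_set_scope.
Local Open Scope ring_scope.

(** * Increments of convex functions *)

Lemma convex_setP (R : realType) (X : lmodType R) (D : set X) (x y : X) (t : R) :
  convex_set D -> 0 <= t <= 1 -> D x -> D y -> D (t *: x + (1 - t) *: y).
Proof.
move=> cD /andP[t0 t1] Dx Dy.
have /set_mem := cD x y (Itv01 t0 t1) (mem_set Dx) (mem_set Dy).
by [].
Qed.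

Lemma convex_functionP (R : realType) (X : lmodType R) (D : set X) (f : X -> R)
    (x y : X) (t : R) :
  convex_function D f -> 0 <= t <= 1 -> D x -> D y ->
  f (t *: x + (1 - t) *: y) <= t * f x + (1 - t) * f y.
Proof.
move=> cf /andP[t0 t1] Dx Dy.
by have := cf (Itv01 t0 t1) x y (mem_set Dx) (mem_set Dy).
Qed.

Section convex_increments.
Context {R : realType} {X : lmodType R} {D : set X} {f : X -> R}.
Hypotheses (cD : convex_set D) (cf : convex_function D f).

Let segE (x v : X) (s t : R) : t != 0 ->
  x + s *: v = (s / t) *: (x + t *: v) + (1 - s / t) *: x.
Proof.
move=> t0; rewrite scalerDr scalerA divfK// addrAC -scalerDl.
by rewrite addrC addrCA subrr addr0 scale1r addrC.
Qed.

Lemma convex_shrink x v s t : 0 <= s <= t -> D x -> D (x + t *: v) ->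
  D (x + s *: v).
Proof.
move=> /andP[s0 st] Dx Dt; have [t0|t0] := eqVneq t 0.
  by have -> : s = t by lra.
have tp : 0 < t by rewrite lt_neqAle eq_sym t0 (le_trans s0 st).
rewrite (segE x v s t0); apply: convex_setP => //.
by rewrite divr_ge0 ?(ltW tp)//= ler_pdivrMr// mul1r.
Qed.

Lemma convex_slope_le x v s t : 0 < s <= t -> D x -> D (x + t *: v) ->
  (f (x + s *: v) - f x) / s <= (f (x + t *: v) - f x) / t.
Proof.
move=> /andP[s0 st] Dx Dt; have tp := lt_le_trans s0 st.
have t0 : t != 0 by rewrite gt_eqF.
have st01 : 0 <= s / t <= 1.
  by rewrite divr_ge0 ?(ltW tp) ?(ltW s0)//= ler_pdivrMr// mul1r.
have := convex_functionP cf st01 Dt Dx; rewrite -segE// => fs.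
rewrite ler_pdivrMr// mulrAC -mulrA; lra.
Qed.

(** Doubling the step turns the sum of two directions into a midpoint, to which convexity
    applies. *)
Let midE (x v w : X) (t : R) :
  x + t *: (v + w) =
  2^-1 *: (x + (2 * t) *: v) + (1 - 2^-1) *: (x + (2 * t) *: w).
Proof.
have -> : 1 - 2^-1 = 2^-1 :> R by lra.
have xx : x + x = 2 *: x by rewrite scaler_nat mulr2n.
rewrite -scalerDr addrACA -scalerDr xx [RHS]scalerDr !scalerA.
by rewrite mulrA mulVf ?pnatr_eq0// scale1r mul1r.
Qed.

Lemma convex_mid_set x v w t : D (x + (2 * t) *: v) -> D (x + (2 * t) *: w) ->
  D (x + t *: (v + w)).
Proof. by move=> Dv Dw; rewrite midE; apply: convex_setP => //; lra. Qed.

Lemma convex_mid x v w t : D (x + (2 * t) *: v) -> D (x + (2 * t) *: w) ->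
  f (x + t *: (v + w)) <= (f (x + (2 * t) *: v) + f (x + (2 * t) *: w)) / 2.
Proof.
move=> Dv Dw; rewrite midE.
apply: (le_trans (convex_functionP cf _ Dv Dw)); lra.
Qed.

(** Slopes decrease with the step, so both may be taken at the common step [r], where [x] is the
    midpoint of [x + r *: v] and [x + r *: - v]. *)
Lemma convex_second_difference_ge0 x v s t : 0 < s -> 0 < t -> D x ->
  D (x + s *: v) -> D (x + t *: - v) ->
  - ((f (x + t *: - v) - f x) / t) <= (f (x + s *: v) - f x) / s.
Proof.
move=> s0 t0 Dx Ds Dt; set r := Num.min s t.
have r0 : 0 < r by rewrite lt_min s0.
have rs : 0 < r <= s by rewrite r0 ge_min lexx.
have rt : 0 < r <= t by rewrite r0 ge_min lexx orbT.
apply: le_trans (convex_slope_le rs Dx Ds); rewrite lerNl.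
apply: le_trans (convex_slope_le rt Dx Dt).
rewrite -mulNr ler_pM2r ?invr_gt0//.
have r2 : 0 <= r / 2 <= r by lra.
have rE (w : X) : r *: w = (2 * (r / 2)) *: w by rewrite mulrCA divff ?mulr1.
have Dr : D (x + r *: v) by apply: convex_shrink Ds => //; lra.
have Dr' : D (x + r *: - v) by apply: convex_shrink Dt => //; lra.
have := @convex_mid x v (- v) (r / 2); rewrite subrr scaler0 addr0 -!rE.
by move=> /(_ Dr Dr'); lra.
Qed.

End convex_increments.

(** * Directional smoothness *)

Section tvs_continuity.
Context {R : realType} {X : tvsType R}.

Lemma tvs_continuousD (T : topologicalType) (g h : T -> X) :
  continuous g -> continuous h -> continuous (fun t => g t + h t).
Proof.
move=> gc hc t; apply: (@continuous2_cvg _ _ _ _ _ _ g h +%R).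
- exact: (@add_continuous X (g t, h t)).
- exact: gc.
- exact: hc.
Qed.

Lemma tvs_continuousZ (T : topologicalType) (k : T -> R^o) (h : T -> X) :
  continuous k -> continuous h -> continuous (fun t => k t *: h t).
Proof.
move=> kc hc t; apply: (@continuous2_cvg _ _ _ _ _ _ k h *:%R).
- exact: (@scale_continuous R X (k t, h t)).
- exact: kc.
- exact: hc.
Qed.

Lemma continuous_line (x v : X) : continuous (fun t : R^o => x + t *: v).
Proof.
apply: tvs_continuousD; first by move=> t; exact: cvg_cst.
by apply: tvs_continuousZ => t; [exact: cvg_id | exact: cvg_cst].
Qed.

Lemma continuous_affine (x : X) (c : R) : continuous (fun v : X => x + c *: v).
Proof.
apply: tvs_continuousD; first by move=> t; exact: cvg_cst.
by apply: tvs_continuousZ => t; [exact: cvg_cst | exact: cvg_id].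
Qed.

Lemma tvs_continuous_shift (v : X) : continuous (fun x : X => x + v).
Proof.
by apply: tvs_continuousD => t; [exact: cvg_id | exact: cvg_cst].
Qed.

Lemma nbhs_line (x v : X) (U : set X) : nbhs x U ->
  exists2 d : R, 0 < d & forall t, `|t| < d -> U (x + t *: v).
Proof.
move=> Ux; have := @continuous_line x v 0 U; rewrite scale0r addr0 => /(_ Ux).
move=> /nbhs_ballP[d /= d0 dU]; exists d => // t td; apply: dU.
by rewrite /ball /= sub0r normrN.
Qed.

Lemma nbhs_affine (x : X) (c : R) (U : set X) : nbhs x U ->
  \forall v \near 0, U (x + c *: v) /\ U (x + c *: - v).
Proof.
move=> Ux; have cU k : \forall v \near 0, U (x + k *: v).
  by apply: continuous_affine; rewrite /= scaler0 addr0.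
near=> v; split; first by near: v; exact: cU.
by rewrite scalerN -scaleNr; near: v; exact: cU.
Unshelve. all: by end_near.
Qed.

End tvs_continuity.

Section directional_smoothness.
Context {R : realType} {X : tvsType R} {D : set X} {f : X -> R}.
Hypotheses (cD : convex_set D) (cf : convex_function D f).
Implicit Types (x v w : X) (e s t : R).

Definition second_difference_lt x v e t :=
  [/\ D (x + t *: v), D (x + t *: - v) &
      f (x + t *: v) + f (x + t *: - v) - 2 * f x < e * t].

(** One step suffices: for convex [f] and [x] in [D] the inequality passes to all smaller steps. *)
Definition nearly_smooth x e v := exists2 t, 0 < t & second_difference_lt x v e t.

Definition smooth_in x v := forall e, 0 < e -> nearly_smooth x e v.

Lemma second_difference_lt_shrink x v e s t : D x -> 0 < s <= t ->
  second_difference_lt x v e t -> second_difference_lt x v e s.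
Proof.
move=> Dx /andP[s0 st] [Dt Dt' ft]; have t0 := lt_le_trans s0 st.
have s0t : 0 <= s <= t by rewrite ltW.
split; [exact: convex_shrink Dt|exact: convex_shrink Dt'|].
have s0' : 0 < s <= t by rewrite s0.
have := convex_slope_le cf s0' Dx Dt.
have := convex_slope_le cf s0' Dx Dt'.
rewrite -ltr_pdivrMr// in ft; rewrite -ltr_pdivrMr//.
rewrite !mulrBl in ft *; rewrite !mulrDl in ft *; lra.
Qed.

(** Midpoint convexity at half the common step [r] bounds the second difference by the mean of those
    along [v] and [w], which is below [e * r = 2 * e * (r / 2)]. *)
Lemma nearly_smoothD x e v w : D x -> nearly_smooth x e v ->
  nearly_smooth x e w -> nearly_smooth x (2 * e) (v + w).
Proof.
move=> Dx [t1 t10 h1] [t2 t20 h2]; set r := Num.min t1 t2.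
have r0 : 0 < r by rewrite lt_min t10.
have r1 : 0 < r <= t1 by rewrite r0 ge_min lexx.
have r2 : 0 < r <= t2 by rewrite r0 ge_min lexx orbT.
have {h1} [Dv Dv' fv] := second_difference_lt_shrink Dx r1 h1.
have {h2} [Dw Dw' fw] := second_difference_lt_shrink Dx r2 h2.
have rE : r = 2 * (r / 2) by rewrite mulrCA divff ?mulr1.
exists (r / 2); first by rewrite divr_gt0.
rewrite {1}rE in Dv fv; rewrite {1}rE in Dv' fv; rewrite {1}rE in Dw fw.
rewrite {1}rE in Dw' fw.
rewrite /second_difference_lt opprD.
split; [exact: (convex_mid_set cD)|exact: (convex_mid_set cD)|].
have := convex_mid cf Dv Dw; have := convex_mid cf Dv' Dw'.
rewrite -?rE in fv fw *; lra.
Qed.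

Lemma smooth_inZ x c v : D x -> smooth_in x v -> smooth_in x (c *: v).
Proof.
move=> Dx xv e e0.
have [->|c0] := eqVneq c 0.
  exists 1 => //; rewrite /second_difference_lt scale0r !scaler0 oppr0 !scaler0.
  by rewrite addr0; split=> //; lra.
have c1 : 0 < `|c| by rewrite normr_gt0.
have [t t0 [Dt Dt' ft]] := xv (e / `|c|) (divr_gt0 e0 c1).
exists (t / `|c|); first exact: divr_gt0.
have E1 w : (t / `|c|) *: (c *: w) = t *: (Num.sg c *: w).
  by rewrite !scalerA {2}[c]numEsg mulrA; congr (_ *: _); field; rewrite normr_eq0.
rewrite /second_difference_lt -scalerN !E1.
rewrite mulrAC -mulrA in ft; move: (e * _) ft => k ft.
case: sgrP c0 => // c00 _; rewrite ?scale1r ?scaleN1r ?opprK//.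
by split=> //; lra.
Qed.

(** The step [c = 4 / e] is fixed first; for small [w] both translates of [x] stay where
    [f < f x + 1], so the second difference is below [2 < e * c]. *)
Lemma nearly_smooth_nbhs0 x e : nbhs x D -> {for x, continuous (f : X -> R^o)} ->
  0 < e -> \forall w \near 0, nearly_smooth x e w.
Proof.
move=> Dx fx e0; set c := 4 / e; have c0 : 0 < c by rewrite divr_gt0.
have fxU : \forall y \near x, f y < f x + 1.
  by apply: (fx [set a | a < f x + 1]); apply: lt_nbhsl; rewrite ltrDl.
have U : nbhs x (D `&` [set y | f y < f x + 1]) by exact: filterI.
apply: filterS (nbhs_affine c U) => w [[/= Dw fw] [Dw' /= fw']].
exists c => //; split=> //; rewrite /c mulrCA divff ?gt_eqF// mulr1 -/c; lra.
Qed.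

Lemma smooth_inD x v w : D x -> smooth_in x v -> smooth_in x w ->
  smooth_in x (v + w).
Proof.
move=> Dx xv xw e e0; have e20 : 0 < e / 2 by rewrite divr_gt0.
have -> : e = 2 * (e / 2) by rewrite mulrCA divff ?mulr1.
by apply: nearly_smoothD => //; [exact: xv | exact: xw].
Qed.

(** Write [v] as [v' + (v - v')] with [v'] smooth and [v - v'] close to 0; each summand is nearly
    smooth for [e / 2]. *)
Lemma smooth_in_closure x v : nbhs x D -> {for x, continuous (f : X -> R^o)} ->
  closure (smooth_in x) v -> smooth_in x v.
Proof.
move=> Dx fx clv e e0; have e20 : 0 < e / 2 by rewrite divr_gt0.
have Dx' := nbhs_singleton Dx.
have := @continuous_affine _ _ v (-1) v [set w | nearly_smooth x (e / 2) w].
rewrite /= scaleN1r subrr => /(_ (nearly_smooth_nbhs0 Dx fx e20)) Wv.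
have [v' [/(_ _ e20) xv']] := clv _ Wv; rewrite /= scaleN1r => Wv'.
have -> : e = 2 * (e / 2) by rewrite mulrCA divff ?mulr1.
by rewrite -[v](subrKC v'); exact: nearly_smoothD.
Qed.

Definition is_directional_derivative x v (l : R) := forall e, 0 < e ->
  exists2 d : R, 0 < d & forall t, 0 < `|t| -> `|t| < d ->
    D (x + t *: v) /\ `|(f (x + t *: v) - f x) / t - l| < e.

Let slopeN x v t : (f (x + t *: v) - f x) / t =
  - ((f (x + (- t) *: - v) - f x) / - t).
Proof. by rewrite scaleNr scalerN opprK invrN mulrN opprK. Qed.

(** The derivative is the infimum of the forward slopes. They decrease to it, and a backward slope
    lies below it but within [e] of a forward one because the second difference is small. *)
Lemma directional_derivative_exists x v : nbhs x D -> smooth_in x v ->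
  exists l, is_directional_derivative x v l.
Proof.
move=> nDx xv; have Dx := nbhs_singleton nDx.
have [d d0 dD] := nbhs_line v nDx.
have dD' s : `|s| < d -> D (x + s *: - v).
  by move=> sd; rewrite scalerN -scaleNr; apply: dD; rewrite normrN.
set S := [set (f (x + t *: v) - f x) / t | t in [set t | 0 < t < d]].
have lbS s : 0 < s < d -> lbound S (- ((f (x + s *: - v) - f x) / s)).
  move=> /andP[s0 sd] _ [t /= /andP[t0 td] <-].
  apply: (convex_second_difference_ge0 cD cf) => //.
    by apply: dD; rewrite gtr0_norm.
  by apply: dD'; rewrite gtr0_norm.
have d2 : 0 < d / 2 < d by lra.
have S0 : S !=set0 by eexists; exists (d / 2).
have hS : has_inf S by split=> //; eexists; exact: lbS d2.
exists (inf S) => e e0.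
have [_ [t1 /= /andP[t10 t1d] <-] ft1] := inf_adherent e0 hS.
have [t2 t20 h2] := xv _ e0.
exists (Num.min d (Num.min t1 t2)); first by rewrite !lt_min d0 t10.
move=> t t0; rewrite !lt_min => /and3P[td tt1 tt2]; split; first exact: dD.
have infS s : 0 < s < d -> inf S <= (f (x + s *: v) - f x) / s.
  by move=> sd; apply: ge_inf; [case: hS | exists s].
case: (ltrP 0 t) => [tp|tn].
  rewrite gtr0_norm// in td tt1.
  have i1 : inf S <= (f (x + t *: v) - f x) / t by apply: infS; rewrite tp.
  rewrite ger0_norm ?subr_ge0// ltrBlDl; apply: le_lt_trans ft1.
  by apply: (convex_slope_le cf); rewrite ?tp ?ltW//; apply: dD; rewrite gtr0_norm.
rewrite normr_gt0 in t0; have {tn t0}tn : 0 < - t.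
  by rewrite oppr_gt0 lt_neqAle t0.
rewrite -normrN gtr0_norm// in td; rewrite -normrN gtr0_norm// in tt2.
have i1 : inf S <= (f (x + (- t) *: v) - f x) / - t by apply: infS; rewrite tn.
have /(lb_le_inf S0) : lbound S ((f (x + t *: v) - f x) / t).
  by rewrite slopeN; apply: lbS; rewrite tn.
have tt2' : 0 < - t <= t2 by rewrite tn ltW.
have [_ _] := second_difference_lt_shrink Dx tt2' h2.
rewrite -ltr_pdivrMr// slopeN; rewrite !mulrBl !mulrDl in i1 *.
by rewrite ltr_norml; lra.
Qed.

(** Midpoint convexity compares the step [t] along [v + w] with the step [2 * t] along [v] and [w].
    As [l], [m], [k] are arbitrary derivatives, this also serves to prove uniqueness. *)
Lemma directional_derivative_le x v w l m k :
  D x -> is_directional_derivative x v l -> is_directional_derivative x w m ->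
  is_directional_derivative x (v + w) k -> k <= l + m.
Proof.
move=> Dx xl xm xk; apply/ler_addgt0Pr => e e0.
have e3 : 0 < e / 3 by rewrite divr_gt0.
have [d1 d10 h1] := xl _ e3; have [d2 d20 h2] := xm _ e3.
have [d3 d30 h3] := xk _ e3.
set t := Num.min (d1 / 2) (Num.min (d2 / 2) d3) / 2.
have t0 : 0 < t by rewrite divr_gt0// !lt_min !divr_gt0.
have [t1 [t2 t3]] : 2 * t < d1 /\ 2 * t < d2 /\ t < d3.
  have : 2 * t <= Num.min (d1 / 2) (Num.min (d2 / 2) d3).
    by rewrite /t mulrCA divff ?mulr1.
  by rewrite !le_min => /and3P[]; lra.
have n2t : `|2 * t| = 2 * t by rewrite gtr0_norm// mulr_gt0.
have p2t : 0 < 2 * t by rewrite mulr_gt0.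
have [|//|Dv fv] := h1 (2 * t); rewrite ?n2t//.
have [|//|Dw fw] := h2 (2 * t); rewrite ?n2t//.
have [|//|Dk fk] := h3 t; rewrite ?gtr0_norm//.
have := convex_mid cf Dv Dw.
move: fv fw fk; rewrite !ltr_norml => /andP[_ +] /andP[_ +] /andP[+ _].
rewrite !ltrBlDr !ltrBrDr !ltr_pdivrMr// ltr_pdivlMr//.
move=> hv hw hk hm.
have : (- (e / 3) + k) * t < (e / 3 + l + (e / 3 + m)) * t by lra.
by rewrite ltr_pM2r//; lra.
Qed.

Lemma directional_derivativeZ x v l c : is_directional_derivative x v l ->
  D x -> is_directional_derivative x (c *: v) (c * l).
Proof.
move=> xl Dx; have [->|c0] := eqVneq c 0.
  move=> e e0; exists 1 => // t _ _.
  by rewrite scale0r scaler0 addr0 subrr !mul0r subrr normr0.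
move=> e e0; have c1 : 0 < `|c| by rewrite normr_gt0.
have [d d0 h] := xl _ (divr_gt0 e0 c1).
exists (d / `|c|); first exact: divr_gt0.
move=> t t0; rewrite ltr_pdivlMr// -normrM => td.
have t0' : t != 0 by rewrite -normr_gt0.
have [|//|Dt ft] := h (t * c); first by rewrite normrM mulr_gt0.
rewrite scalerA; split=> //; rewrite ltr_pdivlMr// -normrM in ft.
suff -> : (f (x + (t * c) *: v) - f x) / t - c * l =
  ((f (x + (t * c) *: v) - f x) / (t * c) - l) * c by [].
by field; rewrite t0' c0.
Qed.

(** This is the subgradient inequality: slopes at small steps lie below the slope at step 1. *)
Lemma directional_derivative_le_increment x v l : D x -> D (x + v) ->
  is_directional_derivative x v l -> l <= f (x + v) - f x.
Proof.
move=> Dx Dv xl; apply/ler_addgt0Pr => e e0; have [d d0 h] := xl _ e0.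
set t := Num.min (d / 2) 1.
have t0 : 0 < t by rewrite lt_min divr_gt0/=.
have t1 : 0 < t <= 1 by rewrite t0 ge_min lexx orbT.
have td : t < d by rewrite gt_min; apply/orP; left; lra.
have tn : `|t| = t by rewrite gtr0_norm.
have [||_] := h t; rewrite ?tn// ltr_norml => /andP[ft _].
have Dv1 : D (x + 1 *: v) by rewrite scale1r.
have := convex_slope_le cf t1 Dx Dv1; rewrite scale1r divr1; lra.
Qed.

Lemma smooth_in_gateaux_differentiable x : nbhs x D -> {for x, continuous (f : X -> R^o)} ->
  (forall v, smooth_in x v) -> gateaux_differentiable D f x.
Proof.
move=> nDx fx xs; have Dx := nbhs_singleton nDx.
have [l xl] := choice (fun v => directional_derivative_exists nDx (xs v)).
have lD v w : l (v + w) <= l v + l w.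
  exact: directional_derivative_le (xl v) (xl w) (xl (v + w)).
have l0 : l 0 = 0.
  have x0 : is_directional_derivative x 0 0.
    by have := directional_derivativeZ 0 (xl 0) Dx; rewrite scale0r mul0r.
  have xl0 := xl 0; rewrite -{1}[0]addr0 in xl0.
  have h1 := directional_derivative_le Dx x0 x0 xl0.
  have x00 : is_directional_derivative x (0 + 0) 0 by rewrite addr0.
  have := directional_derivative_le Dx (xl 0) x0 x00; lra.
(* Each of the two derivatives along [c *: v] is added to the negative of the other; the directions
   cancel, and subadditivity gives both inequalities. *)
have lZ c v : l (c *: v) = c * l v.
  have xc := directional_derivativeZ c (xl v) Dx.
  have xn : is_directional_derivative x (- (c *: v)) (- (c * l v)).
    by have := directional_derivativeZ (-1) xc Dx; rewrite scaleN1r mulN1r.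
  have xn' : is_directional_derivative x (- (c *: v)) (- l (c *: v)).
    by have := directional_derivativeZ (-1) (xl (c *: v)) Dx;
      rewrite scaleN1r mulN1r.
  have x0 : is_directional_derivative x (c *: v + - (c *: v)) 0.
    by rewrite subrr -l0; exact: xl.
  have := directional_derivative_le Dx xc xn' x0.
  have := directional_derivative_le Dx (xl (c *: v)) xn x0; lra.
have lB v w : l (v + w) = l v + l w.
  apply/eqP; rewrite eq_le lD/=.
  have := lD (v + w) (-1 *: w); rewrite lZ scaleN1r addrK; lra.
have lin : linear (l : X -> R^o) by move=> c v w; rewrite lB lZ.
pose L : {linear X -> R^o} :=
  HB.pack (l : X -> R^o) (GRing.isLinear.Build R X R^o *:%R l lin).
exists L; last by move=> v e e0; exact: xl.
have fxU : \forall y \near x, f y < f x + 1.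
  by apply: (fx [set a | a < f x + 1]); apply: lt_nbhsl; rewrite ltrDl.
have U : nbhs x (D `&` [set y | f y < f x + 1]) by exact: filterI.
(* The subgradient inequality at [w] and [- w] bounds [l] by 1 near 0; homogeneity turns this into
   continuity. *)
have W : \forall w \near 0, `|l w| < 1.
  apply: filterS (nbhs_affine 1 U) => w; rewrite !scale1r.
  move=> [[/= Dw fw] [/= Dw' fw']].
  have := directional_derivative_le_increment Dx Dw (xl w).
  have := directional_derivative_le_increment Dx Dw' (xl (- w)).
  have -> : l (- w) = - l w by rewrite -scaleN1r lZ mulN1r.
  rewrite ltr_norml => h1 h2; apply/andP; split; lra.
move=> v; apply/(@cvgrPdist_lt _ R^o) => e e0.
have hc : continuous (fun w : X => e^-1 *: (v + -1 *: w)).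
  by apply: tvs_continuousZ; [move=> w; exact: cvg_cst | exact: continuous_affine].
have /hc : nbhs (e^-1 *: (v + -1 *: v)) [set w | `|l w| < 1].
  by rewrite scaleN1r subrr scaler0.
rewrite nbhs_simpl => lv; apply: (@filterS _ (nbhs v)) lv => w /=.
rewrite lZ lB lZ mulN1r normrM gtr0_norm ?invr_gt0//.
by rewrite mulrC ltr_pdivrMr// mul1r.
Qed.

End directional_smoothness.

(** * Openness and density of the sets of nearly smooth points *)

Section nearly_smooth_points.
Context {R : realType} {X : tvsType R} {D : set X} {f : X -> R}.
Hypotheses (oD : open D) (fc : forall x, D x -> {for x, continuous (f : X -> R^o)}).

Let nbhsD x : D x -> nbhs x D.
Proof. by move=> Dx; exact: open_nbhs_nbhs. Qed.

(** With the step [t] fixed, the condition is a strict inequality that is continuous in the base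
    point. *)
Lemma open_nearly_smooth (v : X) (e : R) :
  open [set x | D x /\ @nearly_smooth R X D f x e v].
Proof.
rewrite openE => x [Dx [t t0 [Dt Dt' ft]]]; rewrite /interior.
have fw w : D (x + w) -> f (y + w) @[y --> x] --> f (x + w).
  move=> Dw; apply: (@cvg_comp _ _ _ (fun y => y + w) (f : X -> R^o) _ (nbhs (x + w))).
    exact: tvs_continuous_shift.
  exact: fc.
have Dn w : D (x + w) -> \forall y \near x, D (y + w).
  by move=> Dw; apply: (@tvs_continuous_shift R X w x); exact: nbhsD.
have lim : f (y + t *: v) + f (y + t *: - v) - 2 * f y @[y --> x] -->
    f (x + t *: v) + f (x + t *: - v) - 2 * f x.
  apply: cvgB; first by apply: cvgD; exact: fw.
  by apply: cvgM; [exact: cvg_cst | exact: fc].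
have flt : \forall y \near x,
    f (y + t *: v) + f (y + t *: - v) - 2 * f y < e * t.
  by apply: (lim [set a | a < e * t]); exact: lt_nbhsl.
near=> y; split; first by near: y; exact: nbhsD.
exists t => //; split; near: y => //; exact: Dn.
Unshelve. all: by end_near.
Qed.

(* If every second difference of step [h] along a segment of length [b] were at
   least [e * h], the increments of [f] over the first and the last step would
   differ by [e * b], whatever [h]; for small [h] this contradicts continuity. *)
Lemma dense_nearly_smooth (v : X) (e : R) (x : X) (U : set X) : 0 < e ->
  D x -> nbhs x U -> exists y, [/\ U y, D y & @nearly_smooth R X D f y e v].
Proof.
move=> e0 Dx Ux; have DUx : nbhs x (D `&` U) by apply: filterI => //; exact: nbhsD.
have [d d0 dDU] := nbhs_line v DUx.
pose g t := f (x + t *: v); pose b := d / 2.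
have b0 : 0 < b by rewrite divr_gt0.
have gc t : `|t| < d -> exists2 r, 0 < r & forall h, `|h| < r ->
    `|g (t + h) - g t| < e * b / 2.
  move=> td; have [Dt _] := dDU _ td.
  have eb : 0 < e * b / 2 by rewrite divr_gt0// mulr_gt0.
  have := fc Dt; move/(@cvgrPdist_lt _ R^o)/(_ _ eb)/(nbhs_line v) => [r r0 hr].
  by exists r => // h /hr; rewrite distrC /g scalerDl addrA.
have [|r1 r10 h1] := gc 0; first by rewrite normr0.
have [|r2 r20 h2] := gc b; first by rewrite gtr0_norm// /b; lra.
pose r := Num.min b (Num.min r1 r2).
have r0 : 0 < r by rewrite !lt_min b0 r10.
(* [n] is so large that [h] is below [r], hence below [b], [r1] and [r2]. *)
pose n := Num.truncn (b / r); pose h := b / n.+1%:R.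
have n0 : 0 < n.+1%:R :> R by rewrite ltr0n.
have h0 : 0 < h by rewrite divr_gt0.
have hn : n.+1%:R * h = b by rewrite /h mulrCA divff ?mulr1// gt_eqF.
have hr : h < r.
  by rewrite /h ltr_pdivrMr// mulrC -ltr_pdivrMr// truncnS_gt.
have [hb [hr1 hr2]] : h < b /\ h < r1 /\ h < r2.
  by move: hr; rewrite !lt_min => /and3P[].
(* One step beyond [b] is still allowed: [n.+2] steps reach [b + h < 2 * b = d]. *)
have kd k : (k <= n.+2)%N -> `|k%:R * h| < d.
  move=> kn; rewrite ger0_norm; last by rewrite mulr_ge0 ?ler0n ?ltW.
  apply: (@le_lt_trans _ _ (n.+2%:R * h)).
    by rewrite ler_pM2r// ler_nat.
  by move: hb; rewrite -[n.+2%:R]natr1 mulrDl hn mul1r /b; lra.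
apply: contrapT => no.
have step : forall k, (k < n.+1)%N ->
    (e * h <= g (k.+2%:R * h) + g (k%:R * h) - 2 * g (k.+1%:R * h))%R.
  move=> k kn; rewrite leNgt; apply/negP => lt.
  have [Dk Uk] := dDU _ (kd k.+1 (ltnW kn)).
  apply: no; exists (x + (k.+1%:R * h) *: v); split => //.
  have E1 : x + (k.+1%:R * h) *: v + h *: v = x + (k.+2%:R * h) *: v.
    by rewrite -addrA -scalerDl -[k.+2%:R]natr1 mulrDl mul1r.
  have E2 : x + (k.+1%:R * h) *: v + h *: - v = x + (k%:R * h) *: v.
    rewrite -addrA scalerN -scaleNr -scalerDl -[k.+1%:R]natr1 mulrDl mul1r.
    by rewrite addrK.
  exists h => //; rewrite /second_difference_lt E1 E2; split => //.
    by have [] := dDU _ (kd k.+2 kn).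
  by have [] := dDU _ (kd k (leq_trans (ltnW kn) (leqnSn _))).
have tele : forall k, (k <= n.+1)%N ->
    g h - g 0 + k%:R * (e * h) <= g (k.+1%:R * h) - g (k%:R * h).
  elim=> [|k IH] kn; first by rewrite mul1r !mul0r addr0.
  have := IH (ltnW kn); have := step k kn.
  by rewrite -[X in _ -> _ -> _ + X * _ <= _]natr1 mulrDl mul1r; lra.
(* The increment from [b] to [b + h] exceeds the one from [0] to [h] by at least [e * b], yet both
   are below [e * b / 2] in absolute value. *)
have := tele n.+1 (leqnn _); rewrite mulrCA hn -[n.+2%:R]natr1 mulrDl hn mul1r.
have := h1 h; have := h2 h; rewrite add0r !(gtr0_norm h0) => /(_ hr2) + /(_ hr1).
by rewrite !ltr_norml => /andP[_ +] /andP[+ _]; lra.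
Qed.

End nearly_smooth_points.

(** * Baire category in metrizable spaces *)

Section metrizable_spaces.
Context {R : realType} {T : topologicalType}.

(** Nested closed balls are chosen, each inside the preceding open ball and inside [F n], with radii
    tending to 0; their centers form a Cauchy sequence whose limit lies in every ball. *)
Lemma completely_metrizable_baire : completely_metrizable R T -> baire_space T.
Proof.
move=> [d [[d0 d_eq dC dT] dnbhs dcomplete]] F oF O [x0 Ox0] oO.
have dxx x : d x x = 0 by apply/d_eq.
(* The implication makes the choice total: a nonpositive radius gets a dummy answer, and [p0] rules
   it out. *)
have next (np : nat * (T * R)) : exists q : T * R, 0 < np.2.2 ->
    [/\ 0 < q.2, q.2 < np.1.+1%:R^-1 &
        forall y, d q.1 y <= q.2 -> d np.2.1 y < np.2.2 /\ F np.1 y].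
  case: np => n [x r] /=; have [r0|r0] := ltrP 0 r; last first.
    by exists (x, r) => /=; rewrite ltNge r0.
  have nx : nbhs x [set y | d x y < r] by apply/dnbhs; exists r.
  have [oFn dFn] := oF n.
  have [z [zx Fz]] : ([set y | d x y < r]^° `&` F n) !=set0.
    by apply: dFn; [exists x; exact: nx | exact: open_interior].
  have : nbhs z ([set y | d x y < r] `&` F n).
    by apply: filterI => //; exact: open_nbhs_nbhs.
  move=> /dnbhs[e e0 he].
  exists (z, Num.min (e / 2) (n.+2%:R^-1)) => _; split => /=.
  - by rewrite lt_min divr_gt0//= invr_gt0 ltr0n.
  - by rewrite gt_min; apply/orP; right; rewrite ltf_pV2 ?posrE ?ltr0n// ltr_nat.
  - move=> y; rewrite le_min => /andP[ye _]; apply: he => /=.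
    by apply: (le_lt_trans ye); lra.
have [nxt hnxt] := choice next.
have /dnbhs[r0 r00 hr0] : nbhs x0 O by exact: open_nbhs_nbhs.
(* The initial radius is [r0 / 2] so that the first closed ball lies in [O]. *)
pose p := fix p n := if n is m.+1 then nxt (m, p m) else (x0, r0 / 2).
have p0 n : 0 < (p n).2.
  by elim: n => [|n IH]; [rewrite divr_gt0 | have [] := hnxt (n, p n) IH].
have pS n y : d (p n.+1).1 y <= (p n.+1).2 -> d (p n).1 y < (p n).2 /\ F n y.
  by have [_ _] := hnxt (n, p n) (p0 n); exact.
have pr n : (p n.+1).2 < n.+1%:R^-1 by have [] := hnxt (n, p n) (p0 n).
have nested n k y : d (p (n + k)%N).1 y <= (p (n + k)%N).2 ->
    d (p n).1 y <= (p n).2.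
  elim: k y => [|k IH] y; first by rewrite addn0.
  by rewrite addnS => /pS[/ltW/IH].
have center n m : (n <= m)%N -> d (p n).1 (p m).1 <= (p n).2.
  by move=> nm; apply: (@nested n (m - n)%N); rewrite subnKC// dxx ltW.
have [l ul] : exists l : T, (fun n => (p n).1) @ \oo --> l.
  apply: dcomplete => e e0.
  pose N := Num.truncn (2 / e).
  have Ne : 2 * N.+1%:R^-1 < e.
    by rewrite ltr_pdivrMr ?ltr0n// mulrC -ltr_pdivrMr// truncnS_gt.
  exists N.+1 => m n mN nN; apply: (le_lt_trans (dT _ (p N.+1).1 _)).
  rewrite dC; have := center _ _ mN; have := center _ _ nN.
  by move: (_^-1) (pr N) Ne => k; lra.
have lp n : d (p n).1 l <= (p n).2.
  apply/ler_addgt0Pr => e e0.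
  have nl : nbhs l [set y | d l y < e] by apply/dnbhs; exists e.
  have [N _ hN] := ul _ nl.
  have := hN (maxn n N) (leq_maxr _ _) => /= lN.
  apply: (le_trans (dT _ (p (maxn n N)).1 _)); apply: lerD; first exact/center/leq_maxl.
  by rewrite dC ltW.
exists l; split; last by move=> n _; have [] := pS n l (lp n.+1).
by apply: hr0 => /=; apply: (le_lt_trans (lp 0%N)) => /=; lra.
Qed.

Lemma separable_space_seq (t0 : T) : separable_space T ->
  exists u : nat -> T, forall O, open O -> O !=set0 -> exists i, O (u i).
Proof.
move=> [S /countable_injP[g ginj] dS].
(* Indices outside the image of [S] under [g] receive the default [t0]. *)
have h n : exists t, forall s, S s -> g s = n -> t = s.
  have [[s [Ss gs]]|no] := pselect (exists s, S s /\ g s = n).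
    by exists s => s' Ss' gs'; apply: ginj; rewrite ?inE// gs gs'.
  by exists t0 => s Ss gs; case: no; exists s.
have [u hu] := choice h; exists u => O oO O0.
by have [s [Os Ss]] := dS O O0 oO; exists (g s); rewrite (hu _ _ Ss erefl).
Qed.

(** Balls of radius [1 / j.+1] about a dense sequence suffice: inside a ball of radius [r], take
    [2 / j.+1 < r] and a center within [1 / j.+1]. Codes that decode to nothing give the whole
    space. *)
Lemma separable_pi_base (t0 : T) : completely_metrizable R T ->
  separable_space T ->
  exists B : nat -> set T, (forall k, open (B k) /\ B k !=set0) /\
    forall V, open V -> V !=set0 -> exists k, B k `<=` V.
Proof.
move=> [d [[d0 d_eq dC dT] dnbhs _]] /(separable_space_seq t0)[u hu].
have dxx x : d x x = 0 by apply/d_eq.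
have ob x r : open [set y | d x y < r].
  rewrite openE => y /= xy; apply/dnbhs; exists (r - d x y); first by rewrite subr_gt0.
  by move=> z /=; rewrite ltrBrDl; exact: le_lt_trans.
exists (fun k => if @unpickle (nat * nat)%type k is Some (i, j)
  then [set y | d (u i) y < j.+1%:R^-1] else setT); split.
  move=> k; case: unpickle => [[i j]|]; last by split; [exact: openT | exists t0].
  by split; [exact: ob | exists (u i); rewrite /= dxx invr_gt0 ltr0n].
move=> V oV [y Vy]; have /dnbhs[r r0 hr] : nbhs y V by exact: open_nbhs_nbhs.
pose j := Num.truncn (2 / r).
have jr : 2 * j.+1%:R^-1 < r.
  by rewrite ltr_pdivrMr ?ltr0n// mulrC -ltr_pdivrMr// truncnS_gt.
have [||i /= hi] := hu [set z | d y z < j.+1%:R^-1]; first exact: ob.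
  by exists y; rewrite /= dxx invr_gt0 ltr0n.
exists (pickle (i, j)); rewrite pickleK => z /= hz; apply: hr => /=.
apply: (le_lt_trans (dT _ (u i) _)).
by move: (_^-1) jr hi hz => k; lra.
Qed.

End metrizable_spaces.

(** * Cylinders over finitely many coordinates *)

Lemma open_exists (S T : topologicalType) (I : Type) (P : I -> Prop)
    (h : I -> S -> T) (O : set T) :
  (forall i, continuous (h i)) -> open O ->
  open [set x | exists i, P i /\ O (h i x)].
Proof.
move=> hc oO; rewrite (_ : [set x | _] = \bigcup_(i in P) h i @^-1` O).
  by apply: bigcup_open => i _; apply: open_comp oO => x _; exact: hc.
by apply/seteqP; split=> x [i]; [move=> [Pi Oi] | move=> Pi Oi]; exists i.
Qed.

Lemma continuous_pair (S T U : topologicalType) (f : S -> T) (g : S -> U) :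
  continuous f -> continuous g -> continuous (fun x => (f x, g x)).
Proof.
move=> fc gc x.
exact: (@cvg_pair _ _ _ (nbhs x) (nbhs (f x)) (nbhs (g x)) _ _ _ f g (fc x) (gc x)).
Qed.

Section cylinders.
Context {R : realType} {E : tvsType R} {A : Type} {F : A -> tvsType R}.
Let Y := prod_topology F.
Let X := (E * Y)%type.
Implicit Types (s : seq {classic A}) (x y : X) (a : {classic A}).

(** Agreement of [0] with [l] is membership of [l] in the subspace [L] attached to [s];
    [{classic A}] supplies decidable equality of indices. *)
Definition agree_on s x y := x.1 = y.1 /\ forall a, a \in s -> x.2 a = y.2 a.

Definition cylinder s (G : set X) := forall x y, agree_on s x y -> G x -> G y.

(** The sets [B s] form a filter base converging to [x.2]: convergence in the product is
    coordinatewise, and for one coordinate a one-element list suffices. *)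
Lemma nbhs_cylinder x (U : set X) : nbhs x U ->
  exists s, forall y, agree_on s x y -> U y.
Proof.
case=> -[U1 U2] /= [xU1 xU2] U12.
pose B s := [set z : Y | forall a, a \in s -> x.2 a = z a].
have FB : Filter (filter_from [set: seq {classic A}] B).
  apply: filter_from_filter; first by exists [::].
  move=> s t _ _; exists (s ++ t) => // z zst.
  by split=> a ast; apply: zst; rewrite mem_cat ast ?orbT.
have xB : filter_from [set: seq {classic A}] B --> (x.2 : Y).
  apply/cvg_sup => a W [C [[C' oC' <-] /= C'x] CW].
  exists [:: (a : {classic A})] => // z /(_ a); rewrite inE eqxx => /(_ erefl) za.
  by apply: CW; rewrite /= -za.
have [s _ sU2] := xB _ xU2; exists s => y [xy1 xy2]; apply: U12; split => /=.
  by rewrite -xy1; exact: nbhs_singleton.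
exact: sU2.
Qed.

Definition set_coord a (m : F a) x : X := (x.1, @dfwith {classic A} F x.2 a m).

Lemma agree_on_set_coord s a (m : F a) x y : agree_on s x y ->
  agree_on (a :: s) (set_coord m x) (set_coord m y).
Proof.
move=> [xy1 xy2]; split=> //= b; rewrite inE => /predU1P[->|bs].
  by rewrite !dfwithin.
have [ab|ab] := eqVneq a b; last by rewrite !dfwithout// xy2.
by move: m; rewrite ab => m; rewrite !dfwithin.
Qed.

Lemma set_coordK a (m : F a) x : set_coord (x.2 a) (set_coord m x) = x.
Proof.
case: x => e y; congr pair; apply: functional_extensionality_dep => b /=.
have [ab|ab] := eqVneq a b; last by rewrite !dfwithout.
by move: m; rewrite ab => m; rewrite !dfwithin.
Qed.

Lemma set_coord_id a x : set_coord (x.2 a) x = x.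
Proof.
case: x => e y; congr pair; apply: functional_extensionality_dep => b /=.
have [ab|ab] := eqVneq a b; last by rewrite dfwithout.
by rewrite -ab dfwithin.
Qed.

Lemma continuous_set_coord_value x a : continuous (fun m : F a => set_coord m x).
Proof.
apply: continuous_pair; first by move=> m; exact: cvg_cst.
exact: (@dfwith_continuous {classic A} F).
Qed.

Lemma continuous_set_coord a (m : F a) : continuous (set_coord m).
Proof.
apply: continuous_pair; first by move=> x; exact: cvg_fst.
apply: continuous_prod_topology => b.
have [ab|ab] := eqVneq a b.
  subst b; have -> : (fun x : X => @dfwith {classic A} F x.2 a m a) = fun=> m.
    by apply/funext => x; rewrite dfwithin.
  by move=> x; exact: cvg_cst.
have -> : (fun x : X => @dfwith {classic A} F x.2 a m b) = fun x => x.2 b.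
  by apply/funext => x; rewrite dfwithout.
move=> x; apply: (cvg_comp snd (fun f : Y => f b) cvg_snd).
exact: prod_topology_proj_continuous.
Qed.

(** Translation by [y - x] is continuous, carries [x] to [y], and moves each point to one that
    agrees with it on [s], so it preserves [D]. *)
Lemma closure_cylinder s (D : set X) : cylinder s D -> cylinder s (closure D).
Proof.
move=> cD x y [xy1 xy2] clx U Uy.
have := @tvs_continuous_shift R X (y - x) x U; rewrite subrKC => /(_ Uy) Ux.
have [z [Dz /= Uz]] := clx _ Ux; exists (z + (y - x)); split=> //.
apply: (cD z) => //; split; first by rewrite /= xy1 subrr addr0.
by move=> a /xy2 xya; rewrite /= !prod_tvs_addE prod_tvs_oppE xya subrr addr0.
Qed.

Hypotheses (E_baire : baire_space E) (F_baire : forall a, baire_space (F a)).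
Hypothesis F_pi_base : forall a, exists B : nat -> set (F a),
  (forall k, open (B k) /\ B k !=set0) /\
  forall V, open V -> V !=set0 -> exists k, B k `<=` V.

(* Kuratowski-Ulam: for all [x] in a residual set, the section of [G n] over [x]
   along the coordinate [a] meets every member of a countable pi-base of [F a],
   hence is dense. *)
Lemma cylinder_baire s (G : nat -> set X) :
  (forall n, [/\ open (G n), dense (G n) & cylinder s (G n)]) ->
  dense (\bigcap_n G n).
Proof.
elim: s G => [|a s IH] G hG O [x Ox] oO.
  (* With no coordinates left, membership in [G n] depends on the component in [E] alone, so the
     slice at [0] is open and dense in [E]. *)
  have cE (y : Y) : continuous (fun e : E => (e, y) : X).
    apply: continuous_pair => e; [exact: cvg_id | exact: cvg_cst].
  have H n : open [set e | G n (e, 0)] /\ dense [set e | G n (e, 0)].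
    have [oG dG cG] := hG n; split.
      by apply: open_comp oG => e _; exact: cE.
    move=> V [e Ve] oV.
    have [||z [Vz Gz]] := dG [set z | V z.1]; first by exists (e, 0).
      by apply: open_comp oV => z _; exact: cvg_fst.
    by exists z.1; split=> //; apply: cG Gz; split.
  have [||e [[y [_ Oey]] Ge]] := E_baire H (O := [set e | exists y : Y, True /\ O (e, y)]).
  - by exists x.1, x.2; split=> //; case: (x) Ox.
  - exact: open_exists.
  exists (e, y); split=> // n _; have [_ _ cG] := hG n.
  by apply: cG (Ge n I); split.
have [B [oB BV]] := F_pi_base a.
(* [H j] collects the points over which the section of [G n] along [a] meets [B k]; the coordinate
   [a] has become irrelevant, so the induction hypothesis for [s] applies. *)
pose H j : set X := if @unpickle (nat * nat)%type j is Some (n, k)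
  then [set x | exists m, B k m /\ G n (set_coord m x)] else setT.
have hH j : [/\ open (H j), dense (H j) & cylinder s (H j)].
  rewrite /H; case: unpickle => [[n k]|]; last first.
    by split=> //; [exact: openT | move=> V [y Vy] _; exists y].
  have [oG dG cG] := hG n; have [oBk [m0 Bm0]] := oB k; split.
  - by apply: open_exists => // m; exact: continuous_set_coord.
  - move=> V [y Vy] oV.
    (* Points of [W] have coordinate [a] in [B k] and can be moved into [V] by changing that
       coordinate alone. *)
    pose W := [set z : X | B k (z.2 a)] `&`
      [set z | exists m, True /\ V (@set_coord a m z)].
    have [||z [[Bz [m [_ Vz]]] Gz]] := dG W.
    + exists (set_coord m0 y); split; first by rewrite /= dfwithin.
      by exists (y.2 a); rewrite set_coordK.
    + apply: openI; last by apply: open_exists => // m; exact: continuous_set_coord.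
      apply: open_comp oBk => z _.
      apply: (cvg_comp snd (fun f : Y => f a) cvg_snd).
      exact: prod_topology_proj_continuous.
    + exists (set_coord m z); split=> //; exists (z.2 a); split=> //.
      by rewrite set_coordK.
  - move=> y z yz [m [Bm Gm]]; exists m; split=> //.
    by apply: cG Gm; exact: agree_on_set_coord.
(* Over this [z] the section of [O] is nonempty and every section of [G n] is open and dense, so the
   Baire property of [F a] finishes. *)
have [||z [[m0 [_ Om0]] Hz]] := IH H hH [set z | exists m, True /\ O (@set_coord a m z)].
- by exists x, (x.2 a); rewrite set_coord_id.
- by apply: open_exists => // m; exact: continuous_set_coord.
have cz := @continuous_set_coord_value z a.
have K n : open [set m | G n (@set_coord a m z)] /\
           dense [set m | G n (@set_coord a m z)].
  have [oG dG cG] := hG n; split; first by apply: open_comp oG => m _; exact: cz.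
  move=> V V0 oV; have [k BkV] := BV V oV V0.
  have := Hz (pickle (n, k)) I; rewrite /H pickleK => -[m [Bm Gm]].
  by exists m; split=> //; exact: BkV.
have [||m [Om Gm]] := F_baire K (O := [set m | O (@set_coord a m z)]).
- by exists m0.
- by apply: open_comp oO => m _; exact: cz.
by exists (set_coord m z); split.
Qed.

End cylinders.

(** * Invariance under translations and the product theorem *)

(* A convex function bounded above on a line does not grow along it, and the
   openness of [D] transports the bound from the line through [x0] to the
   parallel line through [x]. *)
Lemma convex_bounded_line (R : realType) (X : tvsType R) (D : set X)
    (f : X -> R) (x0 l x : X) (M : R) :
  convex_set D -> convex_function D f -> nbhs x D ->
  (forall k, D (x0 + k *: l) /\ f (x0 + k *: l) <= M) ->
  D (x + l) /\ f (x + l) <= f x.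
Proof.
move=> cD cf nDx Dl; have Dx := nbhs_singleton nDx.
(* The segment from [x0] is prolonged beyond [x] inside [D]; with [c = 1 / (1 + t)], [x] combines
   the far end and [x0] with weights [c] and [1 - c]. *)
have [t t0 Dz] : exists2 t, 0 < t & D (x + t *: (x - x0)).
  have [d d0 hd] := nbhs_line (x - x0) nDx; exists (d / 2); first lra.
  by apply: hd; rewrite gtr0_norm; lra.
have [c c0 ct] : exists2 c, 0 < c & 1 - c = c * t.
  by exists (1 + t)^-1; [rewrite invr_gt0; lra | field; lra].
have ct0 : 1 - c != 0 by rewrite ct gt_eqF// mulr_gt0.
have c01 : 0 <= c <= 1 by rewrite ltW//= -subr_ge0 ct ltW// mulr_gt0.
have xk k : x + k *: l =
    c *: (x + t *: (x - x0)) + (1 - c) *: (x0 + (k / (1 - c)) *: l).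
  rewrite !scalerDr !scalerA mulrCA divff// mulr1 -ct scalerN !addrA.
  by congr (_ + _); rewrite -addrA addNr addr0 -scalerDl addrC subrK scale1r.
have Dk k : D (x + k *: l).
  by rewrite xk; apply: convex_setP => //; case: (Dl (k / (1 - c))).
set K := c * f (x + t *: (x - x0)) + (1 - c) * M.
have fk k : f (x + k *: l) <= K.
  have [Dlk flk] := Dl (k / (1 - c)).
  rewrite xk; apply: (le_trans (convex_functionP cf c01 Dz Dlk)).
  by rewrite lerD2l ler_pM2l// ct mulr_gt0.
have Dl1 := Dk 1; rewrite scale1r in Dl1; split=> //.
(* The slope at step 1 is at most the slope at step [k], which is at most [|K - f x| / k <= e]. *)
apply/ler_addgt0Pr => e e0; pose k := `|K - f x| / e + 1.
have k1 : 0 < (1 : R) <= k by rewrite ltr01 lerDr divr_ge0// ltW.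
have := convex_slope_le cf k1 Dx (Dk k); rewrite scale1r divr1.
have kp : 0 < k by lra.
have : (f (x + k *: l) - f x) / k <= e.
  rewrite ler_pdivrMr//; apply: (@le_trans _ _ `|K - f x|).
    by apply: le_trans (ler_norm _); rewrite lerD2r.
  by rewrite /k mulrDr mulrCA divff ?gt_eqF// !mulr1 lerDl ltW.
lra.
Qed.

Lemma nearly_smooth_le (R : realType) (X : tvsType R) (D : set X) (f : X -> R)
    (x v : X) (e e' : R) : e <= e' ->
  @nearly_smooth R X D f x e v -> @nearly_smooth R X D f x e' v.
Proof.
move=> ee [t t0 [Dt Dt' ft]]; exists t => //; split=> //.
by apply: (lt_le_trans ft); rewrite ler_pM2r.
Qed.

Theorem theorem2p2 (R : realType) (E : tvsType R) (A : Type)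
    (F : A -> tvsType R)
    (E_hausdorff : hausdorff_space E)
    (E_separable : separable_space E)
    (E_baire : baire_space E)
    (F_frechet : forall a, frechet_space (F a))
    (F_separable : forall a, separable_space (F a)) :
  weak_asplund (E * prod_topology F)%type.
Proof.
move=> D [x0 Dx0] oD cD f fcD cf.
set X := (E * prod_topology F)%type in D x0 Dx0 oD cD f fcD cf *.
have nbhsD x : D x -> nbhs x D by move=> Dx; exact: open_nbhs_nbhs.
have fc x : D x -> {for x, continuous (f : X -> R^o)}.
  by move=> Dx; rewrite (continuous_open_subspace f oD) in fcD; apply/fcD/mem_set.
have [s hs] : exists s : seq {classic A}, forall y, agree_on s x0 y ->
    D y /\ f y < f x0 + 1.
  apply: (@nbhs_cylinder R E A F x0 (D `&` [set y | f y < f x0 + 1])).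
  apply: filterI; first exact: nbhsD.
  by apply: (fc _ Dx0 [set a | a < f x0 + 1]); apply: lt_nbhsl; rewrite ltrDl.
have agreeD x l : agree_on s 0 l -> agree_on s x (x + l).
  move=> [l1 l2]; split=> [|a /l2 la]; first by rewrite /= -l1 addr0.
  by rewrite /= prod_tvs_addE -la addr0.
have agreeZ k (l : X) : agree_on s 0 l -> agree_on s 0 (k *: l).
  move=> [l1 l2]; split=> [|a /l2 la]; first by rewrite /= -l1 scaler0.
  by rewrite /= prod_tvs_scaleE -la scaler0.
have invl x l : agree_on s 0 l -> D x -> D (x + l) /\ f (x + l) <= f x.
  move=> sl Dx; apply: (@convex_bounded_line _ _ _ _ x0 _ _ (f x0 + 1)) => //.
    exact: nbhsD.
  by move=> k; have [|Dk /ltW] := hs (x0 + k *: l); first exact/agreeD/agreeZ.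
have inv x l : agree_on s 0 l -> D x -> D (x + l) /\ f (x + l) = f x.
  move=> sl Dx; have [Dl fl] := invl _ _ sl Dx; split=> //.
  have sNl : agree_on s 0 (- l) by rewrite -scaleN1r; exact: agreeZ.
  have [_] := invl _ _ sNl Dl; rewrite addrK => fl'.
  by apply/eqP; rewrite eq_le fl.
have inv' x y : agree_on s x y -> D x -> D y /\ f y = f x.
  move=> [xy1 xy2] Dx; rewrite -[y](subrKC x); apply: inv => //.
  split=> [|a /xy2 xya]; first by rewrite /= xy1 subrr.
  by rewrite /= prod_tvs_addE prod_tvs_oppE xya subrr.
have [uE huE] := separable_space_seq 0 E_separable.
have huF a : {u : nat -> F a | forall O, open O -> O !=set0 -> exists i, O (u i)}.
  exact: cid (separable_space_seq 0 (F_separable a)).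
(* The test directions are a dense sequence of [E] and, for each [a] in [s], a dense sequence of
   [F a] placed in coordinate [a]. *)
pose v (o : option (seq_sub s)) (n : nat) : X :=
  if o is Some a then set_coord (sval (huF (ssval a)) n) 0 else (uE n, 0).
pose G j : set X :=
  if @unpickle (option (seq_sub s) * nat * nat)%type j is Some (o, n, m)
  then [set x | D x /\ @nearly_smooth R X D f x m.+1%:R^-1 (v o n)] else D.
have GD j : G j `<=` D.
  by rewrite /G; case: unpickle => [[[i n] m]|] // x [].
have oG j : open (G j).
  rewrite /G; case: unpickle => [[[i n] m]|] //; exact: open_nearly_smooth.
have cylD : cylinder s D by move=> x y xy Dx; have [] := inv' _ _ xy Dx.
have cylG j : cylinder s (G j).
  rewrite /G; case: unpickle => [[[i n] m]|] // x y xy [Dx [t t0 [Dt Dt' ft]]].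
  have xyw w : agree_on s (x + w) (y + w).
    by case: xy => xy1 xy2; split=> [|a /xy2 xya]; rewrite /= ?xy1// !prod_tvs_addE xya.
  have [Dy fy] := inv' _ _ xy Dx; split=> //; exists t => //.
  have [Dyt fyt] := inv' _ _ (xyw (t *: v i n)) Dt.
  have [Dyt' fyt'] := inv' _ _ (xyw (t *: - v i n)) Dt'.
  by split=> //; rewrite fyt fyt' fy.
(* Adding the complement of [closure D] makes the sets dense in the whole space, as [cylinder_baire]
   requires, and adds no point of [D]. *)
have denseG : dense (\bigcap_j (G j `|` ~` closure D)).
  apply: (@cylinder_baire R E A F _ _ _ s) => //.
  - by move=> a; exact: completely_metrizable_baire (F_frechet a).
  - by move=> a; exact: separable_pi_base 0 (F_frechet a) (F_separable a).
  move=> j; split.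
  - by apply: openU => //; apply: closed_openC; exact: closed_closure.
  - move=> V [y Vy] oV; have [clDy|nclDy] := pselect (closure D y); last first.
      by exists y; split=> //; right.
    have [x [Dx Vx]] := clDy V (open_nbhs_nbhs (conj oV Vy)).
    rewrite /G; case: unpickle => [[[i n] m]|]; last by exists x; split=> //; left.
    have m0 : 0 < m.+1%:R^-1 :> R by rewrite invr_gt0 ltr0n.
    have [z [Vz Dz zs]] := dense_nearly_smooth oD fc (v i n) m0 Dx
      (open_nbhs_nbhs (conj oV Vx)).
    by exists z; split=> //; left.
  - move=> x y xy [Gx|nclx]; [left; exact: cylG Gx | right => cly].
    apply: nclx; apply: (closure_cylinder cylD) cly.
    by case: xy => xy1 xy2; split=> // a /xy2.
exists (\bigcap_j G j); split.
- by exists G.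
- by move=> x /(_ 0%N I); exact: GD.
- move=> x Dx U Ux.
  have : nbhs x (D `&` U) by apply: filterI => //; exact: nbhsD.
  move=> nDU.
  have [||z [DUz Gz]] := denseG ((D `&` U)^°); [by exists x | exact: open_interior |].
  have [Dz Uz] := interior_subset DUz.
  exists z; split=> // j _; have [//|] := Gz j I.
  by move=> /(_ (subset_closure Dz)).
move=> x Gx; have Dx : D x by exact: GD (Gx 0%N I).
apply: (smooth_in_gateaux_differentiable cD cf (nbhsD _ Dx) (fc _ Dx)).
pose N := @smooth_in R X D f x.
(* The smooth directions form a closed set, so smoothness of [g] along a dense sequence extends to
   all values of [g]. *)
have Nclosure (T : topologicalType) (g : T -> X) (u : nat -> T) :
    continuous g -> (forall O, open O -> O !=set0 -> exists i, O (u i)) ->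
    (forall n, N (g (u n))) -> forall t, N (g t).
  move=> gc hu Nu t; apply: (smooth_in_closure cD cf (nbhsD _ Dx) (fc _ Dx)).
  move=> U Ut; have [||i Ui] := hu (g @^-1` U)^°; first exact: open_interior.
    by exists t; exact: gc.
  by have gU := interior_subset Ui; exists (g (u i)); split; [exact: Nu | exact: gU].
have Nv o n : N (v o n).
  move=> e e0; pose m := Num.truncn e^-1.
  have := Gx (pickle (o, n, m)) I; rewrite /G pickleK => -[_].
  apply: nearly_smooth_le.
  by rewrite -[e]invrK lef_pV2 ?posrE ?ltr0n ?invr_gt0// ltW// truncnS_gt.
have NE (e : E) : N (e, 0).
  apply: (Nclosure E (fun e => (e, 0)) uE) => //; last by move=> n; exact: (Nv None).
  by apply: continuous_pair => t; [exact: cvg_id | exact: cvg_cst].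
have NF (a : {classic A}) (m : F a) : a \in s -> N (set_coord m 0).
  move=> sa; move: m; apply: (Nclosure _ (fun m => set_coord m 0) (sval (huF a))).
  - exact: continuous_set_coord_value.
  - exact: svalP (huF a).
  - by move=> n; exact: (Nv (Some (SeqSub sa))).
have Nl l : agree_on s 0 l -> N l.
  move=> sl e e0; exists 1 => //.
  have [Dl fl] := inv _ _ sl Dx.
  have [|Dl' fl'] := inv x (- l) _ Dx; first by rewrite -scaleN1r; exact: agreeZ.
  by split; rewrite !scale1r// fl fl' mulr1 mulr_natl mulr2n subrr.
(* The constraints are removed one by one: a vector vanishing on [s'] is the sum of its part at [a],
   smooth by [NF], and a vector vanishing on [a :: s']. With no constraint left, every [(0, y)]
   qualifies. *)
have Ns (s' : seq {classic A}) : {subset s' <= s} ->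
    (forall l, agree_on s' 0 l -> N l) -> forall y, N (0, y).
  elim: s' => [|a s' IH] ss Ns' y; first by apply: Ns'; split.
  apply: IH => [b bs|l [l1 l2]]; first by apply: ss; rewrite inE bs orbT.
  have -> : l = set_coord (l.2 a) 0 + set_coord (0 : F a) l.
    apply: injective_projections; first by rewrite /= add0r.
    apply: functional_extensionality_dep => b; rewrite /= prod_tvs_addE.
    have [ab|ab] := eqVneq a b; last by rewrite !dfwithout// add0r.
    by subst b; rewrite !dfwithin addr0.
  apply: (smooth_inD cD cf) => //; first by apply: NF; apply: ss; rewrite inE eqxx.
  apply: Ns'; split=> //= b; rewrite inE => /predU1P[->|bs].
    by rewrite dfwithin.
  have [ab|ab] := eqVneq a b; last by rewrite dfwithout// -l2.
  by subst b; rewrite dfwithin.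
move=> w; rewrite (_ : w = (w.1, 0) + (0, w.2)); last first.
  by apply: injective_projections; rewrite /= ?addr0 ?add0r.
exact: (smooth_inD cD cf Dx (NE _) (Ns s (fun=> id) Nl _)).
Qed.
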